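(* Let $m\ge 1$ and let $T$ be the set of standard shifted tableaux of staircase shape $\Delta_m=(m,m-1,\ldots,1)$. The number of braid hooks is homomesic on $T$ with respect to the action of the group $\langle\tau_o,\tau_e\rangle$: there is a constant $c$ such that for every orbit $O$ of this group on $T$, $\frac{1}{|O|}\sum_{t\in O}\#\{\text{braid hooks of } t\}=c$.
   Context: The shifted staircase diagram $\Delta_m$ is the set of cells $(r,c)$ with $1\le r\le c\le m$ (row $r$ top to bottom, column $c$ left to right); a standard shifted tableau is a bijective filling with $1,\ldots,N$, $N=m(m+1)/2$, increasing along rows (left to right) and columns (top to bottom). An integer $k$ is a braid hook of $t$ if there is a cell $(r,c)$ with $k-1$ in $(r,c)$, $k$ in $(r,c+1)$, $k+1$ in $(r+1,c+1)$, and $(r+1,c)$ not a cell of the diagram. For $1\le i<N$, $\tau_i:T\to T$ interchanges the entries $i$ and $i+1$ of $t$ if the result is again a standard shifted tableau, and fixes $t$ otherwise. Let $\tau_o=\prod_{i\text{ odd}}\tau_i$ and $\tau_e=\prod_{i\text{ even}}\tau_i$ (the factors in each product commute), two involutions of $T$. *)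

(* Defs.v *)
From HB Require Import structures.
From mathcomp Require Import all_boot all_order all_algebra all_fingroup.

Set Implicit Arguments.
Unset Strict Implicit.
Unset Printing Implicit Defensive.

(* Rows, columns and entries are numbered from 1, so they live in ordinals    *)
(* with one unused value 0.                                                   *)

Definition in_staircase (m r c : nat) : bool := (1 <= r) && (r <= c <= m).

Definition cell (m : nat) : finType :=
  {x : 'I_m.+1 * 'I_m.+1 | in_staircase m x.1 x.2}.

Definition row_of m (x : cell m) : nat := (val x).1.
Definition col_of m (x : cell m) : nat := (val x).2.

Definition ncells (m : nat) : nat := (m * m.+1)./2.

Definition filling (m : nat) : finType := {ffun cell m -> 'I_(ncells m).+1}.

Definition is_standard m (t : filling m) : bool :=
  [&& [forall x, 1 <= t x],
      injectiveb t,
      [forall k : 'I_(ncells m).+1, (1 <= k) ==> [exists x, t x == k]],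
      [forall x, forall y,
         (row_of x == row_of y) && (col_of x < col_of y) ==> (t x < t y)] &
      [forall x, forall y,
         (col_of x == col_of y) && (row_of x < row_of y) ==> (t x < t y)]].

Definition shifted_tableau (m : nat) : finType :=
  {t : filling m | is_standard t}.

Definition braid_hook m (t : shifted_tableau m) (k : nat) : bool :=
  [exists x : cell m, exists y : cell m, exists z : cell m,
    [&& (row_of y == row_of x) && (col_of y == (col_of x).+1),
        (row_of z == (row_of x).+1) && (col_of z == (col_of x).+1),
        ~~ in_staircase m (row_of x).+1 (col_of x) &
        [&& (val t x).+1 == k, val t y == k :> nat & val t z == k.+1 :> nat]]].

Definition num_braid_hooks m (t : shifted_tableau m) : nat :=
  #|[set k : 'I_(ncells m).+1 | braid_hook t k]|.

Definition swap_entries m (i : nat) (t : filling m) : filling m :=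
  [ffun x => tperm (inord i) (inord i.+1) (t x)].

(* [insubd t u] is [u] when [u] is standard, and [t] otherwise.               *)
Definition tau_fun m (i : nat) (t : shifted_tableau m) : shifted_tableau m :=
  insubd t (swap_entries i (val t)).

Lemma swap_entriesK m i : involutive (@swap_entries m i).
Proof. by move=> t; apply/ffunP=> x; rewrite !ffunE tpermK. Qed.

Lemma tau_funK m i : involutive (@tau_fun m i).
Proof.
move=> t; apply: val_inj; rewrite /tau_fun !val_insubd.
case: (boolP (is_standard (swap_entries i (val t)))) => [_ | /negPf->] //.
by have st : is_standard (val t) := valP t; rewrite swap_entriesK st.
Qed.

Definition tau m (i : nat) : {perm shifted_tableau m} :=
  perm (can_inj (@tau_funK m i)).

Definition tau_odd m : {perm shifted_tableau m} :=
  (\prod_(1 <= i < ncells m | odd i) tau m i)%g.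

Definition tau_even m : {perm shifted_tableau m} :=
  (\prod_(1 <= i < ncells m | ~~ odd i) tau m i)%g.

Definition homomesic (T : finType) (G : {group {perm T}}) (f : T -> nat) : Prop :=
  exists c : rat, forall O : {set T}, O \in orbit 'P G @: [set: T] ->
    (#|O|%:R^-1 * \sum_(t in O) (f t)%:R = c)%R.

(* Main.v *)
(* Write a_k for the content (column minus row) of the cell of t containing   *)
(* k. The operator tau_k exchanges the cells of k and k+1 unless they lie in  *)
(* one row or column, in which case a_k and a_(k+1) differ by one, and a      *)
(* braid hook at k is a factor 0 1 0 = a_(k-1) a_k a_(k+1). Let               *)
(* D_k(t) = [a_k < a_(k+2)], and let tau be the one of tau_o, tau_e that      *)
(* contains tau_k, hence also tau_(k+2). If both swaps take place then        *)
(* D_k(tau t) = D_(k+1)(t). A blocked swap changes a compared content by one, *)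
(* which affects the comparison only if equal or nearly equal contents occur  *)
(* very close to each other; the staircase shape leaves one such case:        *)
(*   D_k(tau t) = D_(k+1)(t) + [t has a braid hook at k+2].                   *)
(* Summing over an orbit O and telescoping, the total number of braid hooks   *)
(* at 3, ..., N-1 is the sum over O of D_1 - D_(N-2). For m > 1, D_1 is       *)
(* 1 - [braid hook at 2] as a_1 = 0, and D_(N-2) = 0 as a_N = 0. So the       *)
(* average is 1 (and 0 if m = 1).                                             *)

Require Import Defs.
From mathcomp Require Import all_boot all_order all_algebra all_fingroup.
From mathcomp Require Import zify.

Set Implicit Arguments.
Unset Strict Implicit.
Unset Printing Implicit Defensive.

(** The identity for D_k ([ascent2_tau]) rests on how close together equal contents can occur.
    Between two entries of one diagonal lies the entry of the right neighbour of the first cell and,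
    off the main diagonal, also that of its lower neighbour ([entry_between], [entry_below]). Hence
    a_k = a_(k+1) is impossible, a_k = a_(k+2) forces content 0 and is exactly a braid hook at k+1
    ([same_content_triangle], [braid_hook_content]), and a_k = a_(k+3) leaves little freedom for the
    two cells between ([aligned_of_content]). Once [entry_tau_parity] has located k and k+2 after
    the toggles, the identity is arithmetic on four contents. The telescoping in
    [sum_num_braid_hooks] alternates the parity of k, so it needs a set stable under both
    involutions. *)

Section Cells.

Variable m : nat.
Implicit Types x y z : cell m.

Lemma cell_bounds x : (0 < row_of x) && (row_of x <= col_of x <= m).
Proof. exact: (valP x). Qed.

Lemma cell_eq x y : row_of x = row_of y -> col_of x = col_of y -> x = y.
Proof.
case: x y => [[xr xc] xP] [[yr yc] yP]; rewrite /row_of /col_of /= => er ec.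
by apply: val_inj; congr pair; apply: val_inj.
Qed.

Lemma exists_cell r c : in_staircase m r c ->
  exists x : cell m, row_of x = r /\ col_of x = c.
Proof.
move=> rcP; have [r_lt c_lt] : r < m.+1 /\ c < m.+1.
  by move: rcP; rewrite /in_staircase; lia.
by exists (exist _ (Ordinal r_lt, Ordinal c_lt) rcP : cell m).
Qed.

Definition content x : nat := col_of x - row_of x.

Definition aligned x y : bool :=
  (row_of x == row_of y) || (col_of x == col_of y).

End Cells.

(** * Entries and contents inside one tableau *)

Section Entries.

Variables (m : nat) (t : shifted_tableau m).
Implicit Types x y z : cell m.

Definition entry x : nat := val t x.

Lemma entry_gt0 x : 0 < entry x.
Proof. by have /and5P[/forallP/(_ x)] := valP t. Qed.

Lemma entry_le x : entry x <= ncells m.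
Proof. by rewrite -ltnS; apply: ltn_ord. Qed.

Lemma entry_inj x y : entry x = entry y -> x = y.
Proof.
move=> e; have /and5P[_ /injectiveP/(_ x y) + _ _ _] := valP t.
by apply; apply: val_inj.
Qed.

Lemma exists_entry k : 0 < k <= ncells m -> exists x, entry x = k.
Proof.
case/andP=> k_gt0 k_le; have /and5P[_ _ /forallP + _ _] := valP t.
move/(_ (Ordinal (k_le : k < (ncells m).+1))); rewrite /= k_gt0 /=.
by case/existsP=> x /eqP ex; exists x; rewrite /entry ex.
Qed.

Lemma entry_row x y : row_of x = row_of y -> col_of x < col_of y -> entry x < entry y.
Proof.
move=> er lc; have /and5P[_ _ _ /forallP/(_ x)/forallP/(_ y)/implyP + _] := valP t.
by apply; rewrite er eqxx.
Qed.

Lemma entry_col x y : col_of x = col_of y -> row_of x < row_of y -> entry x < entry y.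
Proof.
move=> ec lr; have /and5P[_ _ _ _ /forallP/(_ x)/forallP/(_ y)/implyP] := valP t.
by apply; rewrite ec eqxx.
Qed.

(** The corner in the row of [x] and the column of [y] lies in the staircase, so a row comparison
    and a column comparison can be chained through it. *)
Lemma entry_mono x y : row_of x <= row_of y -> col_of x <= col_of y ->
  x <> y -> entry x < entry y.
Proof.
move=> ler lec nxy.
have [z [zr zc]] : exists z : cell m, row_of z = row_of x /\ col_of z = col_of y.
  by apply: exists_cell; have := cell_bounds x; have := cell_bounds y; rewrite /in_staircase; lia.
have lexz : entry x <= entry z.
  case: (ltngtP (col_of x) (col_of y)) => [lt|gt|e]; [|by lia|].
    by apply/ltnW/entry_row; lia.
  by rewrite (@cell_eq _ x z) //; lia.
case: (ltngtP (row_of x) (row_of y)) => [lt|gt|e]; [|by lia|].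
  by apply: leq_ltn_trans lexz _; apply: entry_col; lia.
case: (ltngtP (col_of x) (col_of y)) => [lt|gt|e']; [|by lia|].
  exact: entry_row.
by case: nxy; apply: cell_eq.
Qed.

(** Such cells are neighbours: a cell between them would hold an entry strictly between two
    consecutive numbers. *)
Lemma aligned_content x y : aligned x y -> entry y = (entry x).+1 ->
  content y = (content x).+1 \/ content x = (content y).+1.
Proof.
have [bx bY] := (cell_bounds x, cell_bounds y); rewrite /content.
move=> al exy; have nxy : x <> y by move=> e; move: exy; rewrite e; lia.
case/orP: al => /eqP e.
- left; have lt : col_of x < col_of y.
    rewrite ltnNge; apply/negP => le.
    by have := @entry_mono y x _ le (fun h => nxy (esym h)); lia.
  case: (ltngtP (col_of x).+1 (col_of y)) => [lt2|gt|]; [|by lia|by lia].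
  have [z [zr zc]] : exists z : cell m, row_of z = row_of x /\ col_of z = (col_of x).+1.
    by apply: exists_cell; rewrite /in_staircase; lia.
  have := @entry_row x z; have := @entry_row z y; lia.
- right; have lt : row_of x < row_of y.
    rewrite ltnNge; apply/negP => le.
    by have := @entry_mono y x le _ (fun h => nxy (esym h)); lia.
  case: (ltngtP (row_of x).+1 (row_of y)) => [lt2|gt|]; [|by lia|by lia].
  have [z [zr zc]] : exists z : cell m, row_of z = (row_of x).+1 /\ col_of z = col_of x.
    by apply: exists_cell; rewrite /in_staircase; lia.
  have := @entry_col x z; have := @entry_col z y; lia.
Qed.

Lemma content_diag x y : content x = content y -> entry x < entry y ->
  row_of x < row_of y /\ col_of x < col_of y.
Proof.
have [bx bY] := (cell_bounds x, cell_bounds y); rewrite /content => e lt.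
suff: row_of x < row_of y by lia.
rewrite ltnNge; apply/negP => le.
case: (x =P y) => [exy|nxy]; first by move: lt; rewrite exy ltnn.
by have := @entry_mono y x le _ (fun h => nxy (esym h)); lia.
Qed.

Lemma entry_between x y : content x = content y -> entry x < entry y ->
  exists z, [/\ row_of z = row_of x, col_of z = (col_of x).+1,
                entry x < entry z & entry z < entry y].
Proof.
move=> e lt; have [lr lc] := content_diag e lt.
have [bx bY] := (cell_bounds x, cell_bounds y).
have [z [zr zc]] : exists z : cell m, row_of z = row_of x /\ col_of z = (col_of x).+1.
  by apply: exists_cell; rewrite /in_staircase; lia.
exists z; split=> //; first by apply: entry_row; lia.
by apply: entry_mono; try lia; move=> ezy; move: zr; rewrite ezy; lia.
Qed.

Lemma content_neq x y : entry y = (entry x).+1 -> content x <> content y.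
Proof. by move=> exy e; have [] := entry_between e _ => [|z []]; lia. Qed.

Lemma entry_below x y : content x = content y -> entry x < entry y -> 0 < content x ->
  exists z, [/\ row_of z = (row_of x).+1, col_of z = col_of x,
                entry x < entry z & entry z < entry y].
Proof.
move=> e lt cx; have [lr lc] := content_diag e lt.
have [bx bY] := (cell_bounds x, cell_bounds y).
have [z [zr zc]] : exists z : cell m, row_of z = (row_of x).+1 /\ col_of z = col_of x.
  by apply: exists_cell; move: cx; rewrite /content /in_staircase; lia.
exists z; split=> //; first by apply: entry_col; lia.
by apply: entry_mono; try lia; move=> ezy; move: zc; rewrite ezy; lia.
Qed.

(** Otherwise the next diagonal cell [w] lies strictly between, and each of the two gaps contains a
    further entry, so the entries differ by at least 4. *)
Lemma content_next x y : content x = content y -> entry x < entry y ->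
  entry y <= (entry x).+3 ->
  row_of y = (row_of x).+1 /\ col_of y = (col_of x).+1.
Proof.
move=> e lt le; have [lr lc] := content_diag e lt.
have [bx bY] := (cell_bounds x, cell_bounds y).
have [w [wr wc]] : exists w : cell m, row_of w = (row_of x).+1 /\ col_of w = (col_of x).+1.
  by apply: exists_cell; rewrite /in_staircase; lia.
have ew : content w = content x by rewrite /content; lia.
have ltxw : entry x < entry w.
  by apply: entry_mono; try lia; move=> exw; move: wr; rewrite -exw; lia.
case: (w =P y) => [<-//|nwy].
have ltwy : entry w < entry y.
  by apply: entry_mono => //; lia.
have [z1 [_ _ ? ?]] := entry_between (esym ew) ltxw.
have [z2 [_ _ ? ?]] := entry_between (etrans ew e) ltwy.
lia.
Qed.

(** Only [y] fits between, so it is the right neighbour of [x]; with positive content it would have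
    to be the lower neighbour too. *)
Lemma same_content_triangle x y z k :
  entry x = k -> entry y = k.+1 -> entry z = k.+2 -> content x = content z ->
  [/\ row_of y = row_of x /\ col_of y = (col_of x).+1,
      row_of z = (row_of x).+1 /\ col_of z = (col_of x).+1 & content x = 0].
Proof.
move=> ex ey ez e.
have [] := @content_next x z; [lia..|] => zr zc.
have [] := @entry_between x z; [lia..|] => y' [yr yc ? ?].
have eyy : y' = y by apply: entry_inj; lia.
subst y'; split=> //; apply/eqP; rewrite -leqn0 leqNgt; apply/negP => cx.
have [] := @entry_below x z; [lia..|] => y' [yr' yc' ? ?].
have eyy : y' = y by apply: entry_inj; lia.
by move: yr'; rewrite eyy; lia.
Qed.

Lemma braid_hook_content x y z k : entry x = k -> entry y = k.+1 -> entry z = k.+2 ->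
  braid_hook t k.+1 = (content x == content z).
Proof.
move=> ex ey ez; apply/existsP/eqP => [[x' /existsP[y' /existsP[z']]]|e].
  case/and4P=> _ /andP[/eqP zr /eqP zc] _ /and3P[/eqP ex' _ /eqP ez'].
  have -> : x = x' by apply: entry_inj; rewrite /entry in ex *; lia.
  have -> : z = z' by apply: entry_inj; rewrite /entry in ez *; lia.
  by rewrite /content zr zc.
have [[yr yc] [zr zc] cx0] := same_content_triangle ex ey ez e.
exists x; apply/existsP; exists y; apply/existsP; exists z.
have bx := cell_bounds x.
rewrite yr yc zr zc !eqxx /=; rewrite /content in cx0; rewrite /entry in ex ey ez.
by rewrite /in_staircase ex ey ez !eqxx /=; lia.
Qed.

Lemma braid_hook_bounds k : braid_hook t k -> 1 < k < ncells m.
Proof.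
case/existsP=> x /existsP[y /existsP[z /and4P[_ _ _ /and3P[/eqP ex _ /eqP ez]]]].
by have := entry_gt0 x; have := entry_le z; rewrite /entry; lia.
Qed.

(** The right neighbour of [x] lies directly above [w] and has an entry in between; the content of
    [y] rules out [y], so it is [z]. *)
Lemma aligned_of_content x y z w k :
  entry x = k -> entry y = k.+1 -> entry z = k.+2 -> entry w = k.+3 ->
  content x = content w -> content x = (content y).+1 -> aligned z w.
Proof.
move=> ex ey ez ew cxw cxy; have bx := cell_bounds x.
have [] := @content_next x w; [lia..|] => wr wc.
have [] := @entry_between x w; [lia..|] => r [rr rc ? ?].
have nry : r <> y by move=> e; move: cxy; rewrite -e /content rr rc; lia.
have erz : r = z.
  apply: entry_inj; have : entry r <> entry y by move/entry_inj.
  by lia.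
by rewrite /aligned -erz rc wc eqxx orbT.
Qed.

(* D_k in the argument above. *)
Definition ascent2 k : bool :=
  [exists x, exists y, [&& entry x == k, entry y == k.+2 & content x < content y]].

Lemma ascent2E x y k : entry x = k -> entry y = k.+2 -> ascent2 k = (content x < content y).
Proof.
move=> ex ey; apply/existsP/idP=> [[x' /existsP[y' /and3P[/eqP ex' /eqP ey' lt]]]|lt].
  have -> : x = x' by apply: entry_inj; rewrite ex ex'.
  by have -> : y = y' by apply: entry_inj; rewrite ey ey'.
by exists x; apply/existsP; exists y; rewrite ex ey !eqxx.
Qed.

End Entries.

(** * Effect of the toggles on entries and on D_k *)

Section Toggle.

Variable m : nat.
Implicit Types (t : shifted_tableau m) (x y z : cell m).

Lemma entry_swap i t x : i < ncells m ->
  (swap_entries i (val t) x : nat) =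
  if entry t x == i then i.+1 else if entry t x == i.+1 then i else entry t x.
Proof.
move=> iN; have iE : (inord i : 'I_(ncells m).+1) = i :> nat by rewrite inordK //; lia.
have iE' : (inord i.+1 : 'I_(ncells m).+1) = i.+1 :> nat by rewrite inordK //; lia.
rewrite ffunE /entry; case: tpermP => [->|->|/eqP n1 /eqP n2].
- by rewrite iE iE' eqxx.
- by rewrite iE iE' eqxx; case: eqP => //; lia.
by rewrite -!val_eqE /= iE iE' in n1 n2; rewrite (negPf n1) (negPf n2).
Qed.

(** The swap reverses only the comparison between the cells of [i] and [i.+1], which matters exactly
    when they share a line. *)
Lemma swap_standard i t x y : 0 < i < ncells m -> entry t x = i -> entry t y = i.+1 ->
  is_standard (swap_entries i (val t)) = ~~ aligned x y.
Proof.
case/andP=> i_gt0 iN ex ey; have sE z := @entry_swap i t z iN.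
apply/idP/idP => [st|nal].
  apply/negP => al; pose t' : shifted_tableau m := exist (fun u : filling m => is_standard u) _ st.
  have ex' : entry t' x = i.+1 by rewrite /entry /= sE ex eqxx.
  have ey' : entry t' y = i by rewrite /entry /= sE ey eqxx; case: eqP => //; lia.
  have nxy : x <> y by move=> e; move: ey; rewrite -e ex; lia.
  case/orP: al => /eqP e.
    case: (ltngtP (col_of x) (col_of y)) => [lt|gt|ec]; last by case: nxy; apply: cell_eq.
      by have := entry_row t' e lt; rewrite ex' ey'; lia.
    by have := entry_row t (esym e) gt; rewrite ex ey; lia.
  case: (ltngtP (row_of x) (row_of y)) => [lt|gt|er]; last by case: nxy; apply: cell_eq.
    by have := entry_col t' e lt; rewrite ex' ey'; lia.
  by have := entry_col t (esym e) gt; rewrite ex ey; lia.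
have lt_swap z w : entry t z < entry t w -> aligned z w ->
    swap_entries i (val t) z < swap_entries i (val t) w.
  move=> lt al; rewrite !sE.
  have : ~ (entry t z = i /\ entry t w = i.+1).
    case=> ez ew; have xz : x = z by apply: (@entry_inj _ t); rewrite ex ez.
    have yw : y = w by apply: (@entry_inj _ t); rewrite ey ew.
    by move: nal; rewrite xz yw al.
  by do !case: eqP; lia.
apply/and5P; split.
- by apply/forallP=> z; rewrite sE; have := entry_gt0 t z; do !case: eqP; lia.
- apply/injectiveP=> z w; rewrite !ffunE => /perm_inj e.
  by apply: (@entry_inj _ t); rewrite /entry e.
- apply/forallP=> k; apply/implyP=> k_gt0; apply/existsP.
  pose j := tperm (inord i) (inord i.+1) k.
  have j_gt0 : 0 < j.
    rewrite /j; case: tpermP => // _; rewrite inordK //; lia.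
  have [z ez] := @exists_entry _ t j ltac:(by rewrite j_gt0 /= -ltnS ltn_ord).
  by exists z; rewrite ffunE (_ : val t z = j) ?tpermK //; apply: val_inj.
- apply/forallP=> z; apply/forallP=> w; apply/implyP=> /andP[/eqP e lt].
  by apply: lt_swap; [apply: entry_row|rewrite /aligned e eqxx].
apply/forallP=> z; apply/forallP=> w; apply/implyP=> /andP[/eqP e lt].
by apply: lt_swap; [apply: entry_col|rewrite /aligned e eqxx orbT].
Qed.

Lemma entry_tau_far i t x : i < ncells m -> entry t x <> i -> entry t x <> i.+1 ->
  entry (tau m i t) x = entry t x.
Proof.
move=> iN n1 n2; rewrite permE /entry /tau_fun val_insubd; case: ifP => // _.
by rewrite entry_swap //; do 2!case: eqP => //.
Qed.

Lemma entry_tau i t x y : 0 < i < ncells m -> entry t x = i -> entry t y = i.+1 ->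
  entry (tau m i t) (if aligned x y then x else y) = i.
Proof.
move=> iN ex ey; rewrite permE /entry /tau_fun val_insubd (swap_standard iN ex ey).
case: aligned => //=; rewrite entry_swap ?ey; last by case/andP: iN.
by rewrite eqxx; case: eqP => //; lia.
Qed.

Lemma entry_prod_tau_far (s : seq nat) (P : pred nat) t x :
  {in s, forall i, P i -> [&& i < ncells m, entry t x != i & entry t x != i.+1]} ->
  entry ((\prod_(i <- s | P i) tau m i : {perm shifted_tableau m})%g t) x = entry t x.
Proof.
elim: s t => [|i s IHs] t Hs; first by rewrite big_nil perm1.
have Hs' : {in s, forall j, P j -> [&& j < ncells m, entry t x != j & entry t x != j.+1]}.
  by move=> j js; apply: Hs; rewrite inE js orbT.
rewrite big_cons; case: ifP => Pi; last exact: IHs.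
have /and3P[iN /eqP n1 /eqP n2] := Hs i (mem_head _ _) Pi.
have e := entry_tau_far iN n1 n2.
by rewrite permM IHs e.
Qed.

Definition tau_parity (b : bool) : {perm shifted_tableau m} :=
  if b then tau_odd m else tau_even m.

Lemma tau_parityE b :
  tau_parity b = (\prod_(1 <= i < ncells m | odd i == b) tau m i)%g.
Proof. by case: b; apply: eq_bigl => i; case: odd. Qed.

Lemma entry_tau_parity k t x y : 0 < k < ncells m ->
  entry t x = k -> entry t y = k.+1 ->
  entry (tau_parity (odd k) t) (if aligned x y then x else y) = k.
Proof.
case/andP=> k_gt0 kN ex ey; rewrite tau_parityE.
(* Smaller indices of the parity of [k] are at most k-2 and move neither [k] nor [k.+1]; larger
   indices cannot move the entry [k] once [tau m k] has placed it. *)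
rewrite (@big_cat_nat _ _ _ k) ?(@big_ltn_cond _ _ _ k) ?eqxx //=; [|by lia..].
rewrite !permM; set t1 := (\prod_(1 <= i < k | _) _ : {perm _})%g t.
have far z : k <= entry t z <= k.+1 -> entry t1 z = entry t z.
  move=> ez; apply: entry_prod_tau_far => i; rewrite mem_index_iota => ik /eqP oik.
  have ik1 : i.+1 <> k by move=> e; move: oik; rewrite -e /=; case: odd.
  by apply/and3P; split; try apply/eqP; lia.
have ex1 : entry t1 x = k by rewrite far // ex; lia.
have ey1 : entry t1 y = k.+1 by rewrite far // ey; lia.
have e := entry_tau (i := k) _ ex1 ey1.
rewrite entry_prod_tau_far e ?k_gt0 //.
by move=> i; rewrite mem_index_iota => ik _; lia.
Qed.

Lemma ascent2_tau k t : 0 < k -> k.+3 <= ncells m ->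
  ascent2 (tau_parity (odd k) t) k = ascent2 t k.+1 + braid_hook t k.+2 :> nat.
Proof.
move=> k_gt0 kN.
have [x0 e0] : exists x, entry t x = k by apply: exists_entry; lia.
have [x1 e1] : exists x, entry t x = k.+1 by apply: exists_entry; lia.
have [x2 e2] : exists x, entry t x = k.+2 by apply: exists_entry; lia.
have [x3 e3] : exists x, entry t x = k.+3 by apply: exists_entry; lia.
have f01 : entry (tau_parity (odd k) t) (if aligned x0 x1 then x0 else x1) = k.
  by apply: entry_tau_parity => //; lia.
have f23 : entry (tau_parity (odd k) t) (if aligned x2 x3 then x2 else x3) = k.+2.
  by have := @entry_tau_parity k.+2 t x2 x3; rewrite /= negbK; apply => //; lia.
rewrite (ascent2E f01 f23) (ascent2E e1 e3) (braid_hook_content e1 e2 e3).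
have n01 : content x0 <> content x1 by apply: (@content_neq _ t); lia.
have n12 : content x1 <> content x2 by apply: (@content_neq _ t); lia.
have n23 : content x2 <> content x3 by apply: (@content_neq _ t); lia.
have h02 : content x0 = content x2 -> content x0 = 0.
  by case/(same_content_triangle e0 e1 e2).
have h13 : content x1 = content x3 -> content x1 = 0 /\ aligned x2 x3.
  case/(same_content_triangle e1 e2 e3) => [[_ yc] [_ zc] ->].
  by rewrite /aligned yc zc eqxx orbT.
have h03 := aligned_of_content e0 e1 e2 e3.
have a01 : aligned x0 x1 ->
    content x1 = (content x0).+1 \/ content x0 = (content x1).+1.
  by move/(@aligned_content _ t); apply; lia.
have a23 : aligned x2 x3 ->
    content x3 = (content x2).+1 \/ content x2 = (content x3).+1.
  by move/(@aligned_content _ t); apply; lia.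
rewrite !(fun_if (@content m)).
move: n01 n12 n23 h02 h13 h03 a01 a23.
move: (content x0) (content x1) (content x2) (content x3) => c0 c1 c2 c3.
(* Cases by which swaps are blocked. By [h13], a braid hook at k+2 can occur only when the swap of
   k+2 and k+3 is blocked. *)
case: (aligned x0 x1); case: (aligned x2 x3) => n01 n12 n23 h02 h13 h03 a01 a23.
- by have [|] := a01 isT; have [|] := a23 isT; lia.
- have {}a01 := a01 isT; have {}h13 : c1 <> c3 by case/h13.
  have {}h03 : c0 = c3 -> c0 <> c1.+1 by move=> /h03 h /h.
  by lia.
- by have {}a23 := a23 isT; lia.
- by have {}h13 : c1 <> c3 by [case/h13]; lia.
Qed.

End Toggle.

(** * Boundary terms and telescoping over a stable set *)

Section Count.

Variables (m : nat) (m_gt1 : 1 < m).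
Implicit Types (t : shifted_tableau m) (x y z : cell m).

Lemma ncells_ge3 : 3 <= ncells m.
Proof.
have : 2 * 3 <= m * m.+1 by apply: leq_mul.
by rewrite /ncells; lia.
Qed.

(** Otherwise the main-diagonal cell of the same row would hold a smaller entry. *)
Lemma content_first t x : entry t x = 1 -> content x = 0.
Proof.
move=> ex; have bx := cell_bounds x.
have [y [yr yc]] : exists y : cell m, row_of y = row_of x /\ col_of y = row_of x.
  by apply: exists_cell; rewrite /in_staircase; lia.
case: (y =P x) => [eyx|nyx]; first by rewrite /content; rewrite eyx in yc; lia.
by have := entry_gt0 t y; have := @entry_mono _ t y x _ _ nyx; lia.
Qed.

(** Otherwise the main-diagonal cell of the same column would hold a larger entry. *)
Lemma content_last t x : entry t x = ncells m -> content x = 0.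
Proof.
move=> ex; have bx := cell_bounds x.
have [y [yr yc]] : exists y : cell m, row_of y = col_of x /\ col_of y = col_of x.
  by apply: exists_cell; rewrite /in_staircase; lia.
case: (x =P y) => [exy|nxy]; first by rewrite /content; rewrite -exy in yr; lia.
by have := entry_le t y; have := @entry_mono _ t x y _ _ nxy; lia.
Qed.

Lemma ascent2_first t : ascent2 t 1 + braid_hook t 2 = 1.
Proof.
have N3 := ncells_ge3.
have [x ex] : exists x, entry t x = 1 by apply: exists_entry; lia.
have [y ey] : exists x, entry t x = 2 by apply: exists_entry; lia.
have [z ez] : exists x, entry t x = 3 by apply: exists_entry; lia.
rewrite (ascent2E ex ez) (braid_hook_content ex ey ez) (content_first ex).
by case: (content z).
Qed.

Lemma ascent2_last t : ascent2 t (ncells m).-2 = false.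
Proof.
have N3 := ncells_ge3.
have [x ex] : exists x, entry t x = (ncells m).-2 by apply: exists_entry; lia.
have [y ey] : exists x, entry t x = ncells m by apply: exists_entry; lia.
by rewrite (@ascent2E _ _ x y) ?(content_last ey) // ey; lia.
Qed.

Lemma num_braid_hooksE t :
  num_braid_hooks t = \sum_(1 <= k < (ncells m).-1) braid_hook t k.+1.
Proof.
have N3 := ncells_ge3.
rewrite /num_braid_hooks -sum1_card big_mkcond /=.
rewrite (eq_bigr (fun k : 'I__ => nat_of_bool (braid_hook t k))); last first.
  by move=> k _; rewrite inE; case: braid_hook.
rewrite -(big_mkord xpredT (fun k => nat_of_bool (braid_hook t k))).
rewrite -(@big_add1 _ _ _ _ _ xpredT (fun k => nat_of_bool (braid_hook t k))).
have b0 k : ~~ (1 < k < ncells m) -> nat_of_bool (braid_hook t k) = 0.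
  by move=> nk; case: (boolP (braid_hook t k)) => // /braid_hook_bounds; rewrite (negPf nk).
rewrite big_ltn // b0 // big_ltn; last lia.
rewrite b0 // big_nat_recr /=; last lia.
by rewrite b0 ?addn0 ?add0n ?prednK //; lia.
Qed.

Lemma sum_num_braid_hooks (O : {set shifted_tableau m}) :
  (forall b t, (tau_parity m b t \in O) = (t \in O)) ->
  \sum_(t in O) num_braid_hooks t = #|O|.
Proof.
move=> stabO; have N3 := ncells_ge3.
have step k : 0 < k -> k.+3 <= ncells m -> \sum_(t in O) ascent2 t k =
    \sum_(t in O) ascent2 t k.+1 + \sum_(t in O) braid_hook t k.+2.
  move=> k_gt0 kN; rewrite -big_split (reindex_inj (@perm_inj _ (tau_parity m (odd k)))) /=.
  by apply: eq_big => [t|t _]; rewrite ?stabO // ascent2_tau.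
(* Each step trades D_(n+1) for D_(n+2) plus the hooks at n+3; at n = N-3 the D term vanishes by
   [ascent2_last]. *)
have tele n : n.+3 <= ncells m ->
    \sum_(t in O) ascent2 t n.+1 + \sum_(1 <= k < n.+2) \sum_(t in O) braid_hook t k.+1
    = #|O|.
  elim: n => [|n IHn] nN.
    rewrite big_nat1 -big_split -sum1_card.
    by apply: eq_bigr => t _; apply: ascent2_first.
  rewrite -IHn; last exact: ltnW.
  by rewrite (@big_nat_recr _ _ _ n.+2) // (step n.+1) // -addnA; congr (_ + _); apply: addnC.
rewrite (eq_bigr _ (fun t _ => num_braid_hooksE t)) exchange_big /=.
have := tele (ncells m - 3); rewrite (_ : (ncells m - 3).+1 = (ncells m).-2); last lia.
rewrite (_ : (ncells m).-2.+1 = (ncells m).-1); last lia.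
rewrite big1 => [|t _]; last by rewrite ascent2_last.
by apply; lia.
Qed.

End Count.

Theorem theorem1p6 (m : nat) (hm : 1 <= m) :
  homomesic <<[set tau_odd m; tau_even m]>>%G (@num_braid_hooks m).
Proof.
set G := <<_>>%G; case: (ltnP 1 m) => [m_gt1|m_le1].
  exists 1%R => _ /imsetP[t0 _ ->]; set O := orbit _ _ _.
  have O_gt0 : 0 < #|O| by apply/card_gt0P; exists t0; apply: orbit_refl.
  rewrite -GRing.natr_sum sum_num_braid_hooks // => [|b t].
    by rewrite GRing.mulVf // Num.Theory.pnatr_eq0 -lt0n.
  have tauG : tau_parity m b \in G.
    by apply: mem_gen; rewrite !inE; case: b; rewrite eqxx ?orbT.
  exact: orbit_actr _ _ tauG.
exists 0%R => O _; rewrite big1 ?GRing.mulr0 // => t _.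
rewrite (_ : num_braid_hooks t = 0) //; apply: eq_card0 => k; rewrite in_set.
apply/negbTE/negP => /braid_hook_bounds.
have : ncells m = 1 by rewrite /ncells (_ : m = 1) //; lia.
by lia.
Qed.
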